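(* For $k,p_1,\ldots,p_k\in\mathbb N$ and all $i\in\{0,1,\ldots,k\}$ we have $$\lim_{p_1,\ldots,p_k\to\infty}\rho\left(\operatorname{cox}_{S^{(i)}_{p_1,\ldots,p_k}}\right)=k-1.$$
   Context: $\mathbb N$ denotes the set of nonnegative integers. Coxeter polynomial. Let $\Gamma$ be a tree with vertices $v_1,\ldots,v_n$ and adjacency matrix $[a_{ij}]$. For $1\le i\le n$ let $\sigma_i:\mathbb R^n\to\mathbb R^n$ be the linear map with $\sigma_i(e_j)=e_j-(2\delta_{ij}-a_{ij})e_i$, where $e_1,\ldots,e_n$ is the standard basis. The Coxeter transformation is $\Phi_\Gamma=\sigma_1\sigma_2\cdots\sigma_n$, and the Coxeter polynomial is its characteristic polynomial $\operatorname{cox}_\Gamma(t)=\det(t\cdot\mathrm{id}-\Phi_\Gamma)\in\mathbb Z[t]$; it does not depend on the enumeration of the vertices. For a monic integer polynomial $f$, $\rho(f)$ is the maximum of $|z|$ over the complex roots $z$ of $f$. Join. The join of graphs $\Gamma_1,\ldots,\Gamma_k$ with a fixed vertex $v_j$ in each $\Gamma_j$ is the graph obtained from their disjoint union by adding a new vertex $v$ and an edge from $v$ to $v_j$ for every $j$. Dynkin diagrams. $\mathbb A_n$ is the path with vertices $1,2,\ldots,n$ ($\mathbb A_0$ is empty and contributes no branch to a join). $\mathbb D_n$ is the tree with vertices $1,\ldots,n$ consisting of the path $1,2,\ldots,n-2$ together with two further vertices $n-1$ and $n$, each joined by an edge to the vertex $n-2$ (for $n=3$ this is the path $2,1,3$).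 The trees $S^{(i)}_{p_1,\ldots,p_k}$. For $k\in\mathbb N$, $p_1,\ldots,p_k\in\mathbb N$ and $i\in\{0,1,\ldots,k\}$, $S^{(i)}_{p_1,\ldots,p_k}$ is the join of the Dynkin diagrams $\mathbb D_{p_1},\ldots,\mathbb D_{p_i}$ and $\mathbb A_{p_{i+1}},\ldots,\mathbb A_{p_k}$ at their vertices numbered $1$. Multiple limits are iterated limits: $\lim_{p_1,\ldots,p_k\to\infty}\alpha=\lim_{p_1\to\infty}(\cdots(\lim_{p_k\to\infty}\alpha))$.
   Formalization: The theorem is proved for k ≥ 2 only; for k = 0 (a single vertex) and k = 1 (the trees A_{p+1}, D_{p+1}) the spectral radius is always 1, so the claimed value k−1 is false there. *)

(* Defs.v *)
From HB Require Import structures.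
From mathcomp Require Import all_boot all_order all_algebra.
From mathcomp Require Import boolp classical_sets reals topology normedtype.
From mathcomp Require Import complex.

Set Implicit Arguments.
Unset Strict Implicit.
Unset Printing Implicit Defensive.
Import Order.TTheory GRing.Theory Num.Theory.
Import numFieldNormedType.Exports.

Local Open Scope ring_scope.

(* Matrices act on column vectors: the j-th column of [reflection_mx A i] is
   e_j - (2 delta_ij - a_ij) e_i. *)
Definition reflection_mx (n : nat) (A : 'M[int]_n) (i : 'I_n) : 'M[int]_n :=
  \matrix_(r, j) ((r == j)%:R - (2 * (i == j)%:R - A i j) * (r == i)%:R).

Definition coxeter_mx (n : nat) (A : 'M[int]_n) : 'M[int]_n :=
  \big[mulmx/1%:M]_(i < n) reflection_mx A i.

(* The vertices of a graph on a finite type are enumerated by [enum_val]; for a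
   tree the Coxeter polynomial does not depend on the enumeration. *)
Definition adjacency_mx (T : finType) (e : rel T) : 'M[int]_#|T| :=
  \matrix_(i, j) (e (enum_val i) (enum_val j))%:R.

Definition cox (T : finType) (e : rel T) : {poly int} :=
  char_poly (coxeter_mx (adjacency_mx e)).

Definition complex_roots (R : realType) (f : {poly int}) : seq R[i] :=
  sval (closed_field_poly_normal (map_poly intr f : {poly R[i]})).

Definition rho (R : realType) (f : {poly int}) : R :=
  \big[Num.max/0]_(z <- complex_roots R f) ComplexField.Normc.normc z.

(* [None] is the new vertex; [b i] is the fixed vertex of the i-th graph, and is
   [None] only for an empty graph, which then contributes no branch. *)
Definition join_rel (I : finType) (V : I -> finType) (E : forall i, rel (V i))
    (b : forall i, option (V i)) : rel (option {i : I & V i}) :=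
  fun x y =>
    match x, y with
    | None, None => false
    | None, Some u | Some u, None => b (tag u) == Some (tagged u)
    | Some u, Some w =>
        (tag u == tag w) && E (tag u) (tagged u) (tagged_as u w)
    end.

(* Edges of the Dynkin diagrams in terms of the vertex numbers 1, ..., n, each
   edge being listed in one direction. *)
Definition A_edge : rel nat := fun a b => b == a.+1.

Definition D_edge (n : nat) : rel nat := fun a b =>
  ((b == a.+1) && (b <= n - 2)%N) ||
  ((a == n - 2)%N && ((b == n - 1)%N || (b == n))).

(* The ordinal x stands for the vertex numbered x.+1. *)
Definition dynkin_rel (edge : rel nat) (n : nat) : rel 'I_n :=
  fun x y => edge x.+1 y.+1 || edge y.+1 x.+1.

Definition A_rel (n : nat) : rel 'I_n := @dynkin_rel A_edge n.

(* Meaningful for n >= 3 only. *)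
Definition D_rel (n : nat) : rel 'I_n := @dynkin_rel (D_edge n) n.

Definition vertex1 (n : nat) : option 'I_n := insub 0%N.

(* The tree S^(i)_(p_1, ..., p_k), where k = size p and p_j = nth 0 p (j - 1). *)
Definition S_rel (i : nat) (p : seq nat) :
    rel (option {j : 'I_(size p) & 'I_(nth 0%N p j)}) :=
  @join_rel 'I_(size p) (fun j => 'I_(nth 0%N p j))
    (fun j => if (j < i)%N then @D_rel (nth 0%N p j) else @A_rel (nth 0%N p j))
    (fun j => vertex1 (nth 0%N p j)).

(* [is_iterated_lim [:: m_1; ...; m_k] f l] means that
   lim_(p_1 -> oo) (... (lim_(p_k -> oo) f [:: p_1; ...; p_k])) = l, where p_j
   ranges over the integers >= m_j and every inner limit is required to exist
   for all such values of the remaining variables. *)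
Fixpoint is_iterated_lim (R : realType) (m : seq nat) (f : seq nat -> R)
    (l : R) : Prop :=
  if m is m1 :: m' then
    exists2 g : nat -> R,
      forall p1 : nat, (m1 <= p1)%N ->
        is_iterated_lim m' (fun p => f (p1 :: p)) (g p1)
      & (g @ \oo --> l)%classic
  else f [::] = l.

(* Main.v *)
(* Outside the unit circle, [s^2] is a root of the Coxeter polynomial of a tree iff
   [s + 1/s] is an eigenvalue of its adjacency matrix [A]: with [U] and [L] the
   unitriangular parts of [2 - A], the Coxeter transformation is [- U^-1 L], and on
   a tree the pencil [s^2 U + L] is diagonally conjugate to [(s^2 + 1) - s A].
   As [A] is symmetric, [s] is then real.

   On each branch the equation [A f = (s + 1/s) f] is solved explicitly by
   hyperbolic sines (for [A_p]) or cosines (for [D_p]); this leaves only the equation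
   [s + 1/s = q s] at the center, where [q] is the sum of the ratios
   [sinh (p u) / sinh ((p+1) u)] and [cosh ((p-2) u) / cosh ((p-1) u)], [s = exp u].
   The explicit solution is positive, so it is an eigenvector when equality holds and
   bounds the spectrum from above when [q s <= s + 1/s]. Hence the spectral radius is
   the square of the last [s > 1] with [s + 1/s <= q s] (and 1 if there is none).
   Each ratio is nonincreasing in [s] and tends to [1/s] as [p -> oo], so this
   threshold passes to the limit, where the equation becomes [s + 1/s = k/s]. *)
Require Import Defs.
From mathcomp Require Import all_boot all_order all_algebra.
From mathcomp Require Import zify ring lra.
From mathcomp Require Import boolp classical_sets reals topology normedtype.
From mathcomp Require Import sequences realfun complex.

Set Implicit Arguments.
Unset Strict Implicit.
Unset Printing Implicit Defensive.
Import Order.TTheory GRing.Theory Num.Theory.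
Import numFieldNormedType.Exports.
Import ComplexField.

Local Open Scope ring_scope.
Local Open Scope classical_set_scope.

(** * The Coxeter matrix and the adjacency matrix *)

Definition upper_mx (n : nat) (A : 'M[int]_n) : 'M[int]_n :=
  \matrix_(i, j) ((i == j)%:R - A i j *+ (i < j)%N).

Definition lower_mx (n : nat) (A : 'M[int]_n) : 'M[int]_n :=
  \matrix_(i, j) ((i == j)%:R - A i j *+ (j < i)%N).

(** Left multiplication by a reflection alters row [i] only; this is the coordinate update used in
    the induction below. *)
Lemma reflection_mul (n : nat) (A P : 'M[int]_n) (i r j : 'I_n) :
  (reflection_mx A i *m P) r j =
    P r j - (P i j *+ 2 - \sum_l A i l * P l j) *+ (r == i).
Proof.
rewrite mxE.
under eq_bigr => l _ do rewrite mxE mulrBl.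
rewrite sumrB; congr (_ - _).
  rewrite (bigD1 r) //= eqxx mul1r big1 ?addr0 // => l /negbTE.
  by rewrite eq_sym => ->; rewrite mul0r.
case: (r == i); last by rewrite mulr0n big1 // => l _; rewrite mulr0 mul0r.
rewrite mulr1n.
under eq_bigr => l _ do rewrite mulr1 mulrBl.
rewrite sumrB; congr (_ - _).
rewrite (bigD1 i) //= eqxx mulr1 big1 ?addr0 => [|l /negbTE].
  by rewrite mulr_natl.
by rewrite eq_sym => ->; rewrite mulr0 mul0r.
Qed.

(* [w = P v] is computed by updating the coordinates of [v] one at a time, from
   the last index of [s] to the first; when row [j] is updated, the rows after
   it have their final values and those before it are untouched. *)
Lemma reflection_prod_row (n : nat) (A : 'M[int]_n) (s : seq 'I_n) :
    (forall i, A i i = 0) ->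
    pairwise (fun i j : 'I_n => (i < j)%N) s ->
  let P := \big[mulmx/1%:M]_(i <- s) reflection_mx A i in
  (forall i j, i \notin s -> P i j = (i == j)%:R) /\
  (forall i j, i \in s ->
     P i j - \sum_l (A i l *+ (i < l)%N) * P l j =
     - ((i == j)%:R - A i j *+ (j < i)%N)).
Proof.
move=> A0; elim: s => [|k s IH] /=; first by rewrite big_nil; split=> // i j _; rewrite mxE.
move=> /andP[/allP ks /IH[{IH}]]; rewrite big_cons.
set P := \big[_/_]_(_ <- _) _ => Pout Pin.
have knot : k \notin s by apply/negP => /ks; rewrite ltnn.
have Pk r j : r != k -> (reflection_mx A k *m P) r j = P r j.
  by rewrite reflection_mul => /negbTE->; rewrite mulr0n subr0.
split=> i j; rewrite inE.
  by rewrite negb_or => /andP[ik /Pout]; rewrite Pk.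
have [->{i} _|ik /= si] := eqVneq i k; last first.
  rewrite Pk // -Pin //; congr (_ - _); apply: eq_bigr => l _.
  case: (ltnP i l) => [il|_]; last by rewrite !mul0r.
  congr (_ * _); rewrite Pk //; apply: contraTneq il => ->.
  by rewrite -leqNgt ltnW // ks.
have -> : \sum_l (A k l *+ (k < l)%N) * (reflection_mx A k *m P) l j =
          \sum_l (A k l *+ (k < l)%N) * P l j.
  apply: eq_bigr => l _; case: (ltnP k l) => [kl|]; last by rewrite !mul0r.
  by rewrite Pk // neq_ltn kl orbT.
rewrite reflection_mul eqxx mulr1n Pout //.
(* The sum over neighbours is split at [k]. The rows before [k] are not in [s], so they are still
   rows of the identity and contribute just [A k j] when [j < k]. *)
have -> : \sum_l A k l * P l j =
    \sum_l (A k l *+ (k < l)%N) * P l j + A k j *+ (j < k)%N.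
  have -> : A k j *+ (j < k)%N =
            \sum_l (A k l *+ (l < k)%N) * (l == j)%:R.
    rewrite (bigD1 j) //= eqxx mulr1 [X in _ = _ + X]big1 ?addr0 // => l /negbTE->.
    by rewrite mulr0.
  rewrite -big_split; apply: eq_bigr => l _ /=.
  case: (ltngtP k l) => [||/val_inj <-] /=; last by rewrite A0 !mul0r add0r.
    by rewrite mul0r addr0.
  move=> lk; rewrite mul0r add0r mulr1n Pout //.
  by apply: contraTN lk => /ks; rewrite -leqNgt => /ltnW.
by rewrite mulr2n; ring.
Qed.

Lemma upper_coxeter (n : nat) (A : 'M[int]_n) : (forall i, A i i = 0) ->
  upper_mx A *m coxeter_mx A = - lower_mx A.
Proof.
move=> A0; rewrite /coxeter_mx.
have [|_ Pin] := @reflection_prod_row n A (index_enum 'I_n) A0.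
  rewrite -sorted_pairwise; last by move=> ? ? ?; apply: ltn_trans.
  rewrite -(@sorted_map _ _ val ltn) /index_enum -enumT val_enum_ord.
  exact: iota_ltn_sorted.
apply/matrixP => i j; rewrite !mxE -Pin ?mem_index_enum //.
under eq_bigr => l _ do rewrite mxE mulrBl.
rewrite sumrB; congr (_ - _).
rewrite (bigD1 i) //= eqxx mul1r big1 ?addr0 // => l /negbTE.
by rewrite eq_sym => ->; rewrite mul0r.
Qed.

Lemma det_upper_mx (n : nat) (A : 'M[int]_n) : \det (upper_mx A) = 1.
Proof.
rewrite -det_tr det_trig; last first.
  apply/is_trig_mxP => i j ij; rewrite !mxE -val_eqE /= gtn_eqF // ltnNge.
  by rewrite ltnW //= subr0.
by rewrite big1 // => i _; rewrite !mxE eqxx ltnn subr0.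
Qed.

Lemma det_lower_mx (n : nat) (A : 'M[int]_n) : \det (lower_mx A) = 1.
Proof.
rewrite det_trig; last first.
  apply/is_trig_mxP => i j ij; rewrite !mxE -val_eqE /= ltn_eqF // ltnNge.
  by rewrite ltnW //= subr0.
by rewrite big1 // => i _; rewrite !mxE eqxx ltnn subr0.
Qed.

Lemma size_cox (T : finType) (e : rel T) : size (cox e) = #|T|.+1.
Proof. exact: size_char_poly. Qed.

Lemma cox_monic (T : finType) (e : rel T) : cox e \is monic.
Proof. exact: char_poly_monic. Qed.

(** As [U *m P = - L] with [U] unimodular, a left eigenvector [v] of the Coxeter matrix corresponds
    to [u = v U^-1], which is killed by the pencil [z U + L]. *)
Lemma root_char_coxeter (K : fieldType) (n : nat) (A : 'M[int]_n) (z : K) :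
    (forall i, A i i = 0) ->
  root (map_poly intr (char_poly (coxeter_mx A))) z <->
  exists2 u : 'rV[K]_n, u != 0 &
    u *m (z *: map_mx intr (upper_mx A) + map_mx intr (lower_mx A)) = 0.
Proof.
move=> A0.
set U := map_mx intr _; set L := map_mx intr _; set P := coxeter_mx A.
have UP : U *m map_mx intr P = - L.
  by rewrite -map_mxM upper_coxeter // map_mxN.
have uU : U \in unitmx by rewrite unitmxE det_map_mx det_upper_mx rmorph1 unitr1.
rewrite map_char_poly -eigenvalue_root_char; split.
  case/eigenvalueP => v vP v0; exists (v *m invmx U).
    by apply: contra_neq v0 => /(congr1 (mulmxr U)); rewrite /= mulmxKV // mul0mx.
  have -> : L = - (U *m map_mx intr P) by rewrite UP opprK.
  by rewrite mulmxDr -scalemxAr mulmxKV // mulmxN mulmxA mulmxKV // vP subrr.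
move=> [u u0 uz]; apply/eigenvalueP; exists (u *m U).
  rewrite -mulmxA UP mulmxN; move: uz; rewrite mulmxDr -scalemxAr.
  by move/eqP; rewrite addr_eq0 => /eqP->.
by apply: contra_neq u0 => /(congr1 (mulmxr (invmx U))); rewrite /= mulmxK // mul0mx.
Qed.

Definition graph_eigenvector (K : pzRingType) (T : finType) (e : rel T) (x : K)
    (f : T -> K) : Prop :=
  (exists v, f v != 0) /\ forall v, \sum_(w | e v w) f w = x * f v.

(** Put [u = c f]. Off the diagonal the pencil has entries [- s^2] above and [- 1] below; the ratios
    prescribed for [c] turn both into [- s c_j], and the diagonal gives [s^2 + 1 = s (s + 1/s)].
    Column [j] is then [s c_j] times the defect of the eigenvalue equation for [f]. *)
Lemma root_cox (K : fieldType) (T : finType) (e : rel T) (s : K) (c : T -> K) :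
    symmetric e -> irreflexive e -> s != 0 ->
    (forall v, c v != 0) ->
    (forall v w, e v w -> (enum_rank v < enum_rank w)%N -> c w = s * c v) ->
  root (map_poly intr (cox e)) (s ^+ 2) <->
  exists f : T -> K, graph_eigenvector e (s + s^-1) f.
Proof.
move=> e_sym eirr s0 c0 cE; rewrite /cox root_char_coxeter; last first.
  by move=> i; rewrite mxE eirr.
set M := _ + _.
have coef (u : 'rV[K]_#|T|) (f : T -> K) :
    (forall i, u 0 i = c (enum_val i) * f (enum_val i)) ->
  forall j, (u *m M) 0 j = s * c (enum_val j) *
      ((s + s^-1) * f (enum_val j) - \sum_(w | e (enum_val j) w) f w).
  move=> uE j; rewrite mxE (bigID (fun i => i == j)) /= big_pred1_eq.
  rewrite !mxE eqxx !ltnn !mulr0n !subr0 !mulr1 uE.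
  have -> : \sum_(i < #|T| | i != j) u 0 i * M i j =
      - (s * c (enum_val j) * \sum_(w | e (enum_val j) w) f w).
    rewrite mulr_sumr -sumrN [RHS](reindex_onto enum_val enum_rank) /=; last first.
      by move=> w _; rewrite enum_rankK.
    rewrite [RHS](eq_bigl (fun i => e (enum_val i) (enum_val j))); last first.
      by move=> i; rewrite enum_valK eqxx andbT e_sym.
    rewrite (bigID (fun i => e (enum_val i) (enum_val j))) /= addrC big1; last first.
      move=> i /andP[/negbTE ij /negbTE eij].
      by rewrite !mxE ij eij /= !mul0rn subrr rmorph0 mulr0 addr0 mulr0.
    rewrite add0r; apply: eq_big => [i|i /andP[/negbTE ij eij]].
      by case: eqVneq => [->|//]; rewrite eirr.
    rewrite !mxE ij eij !sub0r uE !rmorphN /=.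
    case: (ltngtP i j) => [lij|lji|/val_inj]; last by move/eqP; rewrite ij.
      rewrite mulr1n mulr0n rmorph0 rmorph1 (cE _ (enum_val j) eij) ?enum_valK //.
      by ring.
    rewrite mulr1n mulr0n rmorph0 rmorph1 (cE (enum_val j) (enum_val i)) ?enum_valK ?(e_sym _ (enum_val i)) //.
    by ring.
  by rewrite rmorph1; field.
split.
  move=> [u u0 uM]; exists (fun v => u 0 (enum_rank v) / c v).
  have uE i : u 0 i = c (enum_val i) * (u 0 (enum_rank (enum_val i)) / c (enum_val i)).
    by rewrite enum_valK mulrC divfK.
  split.
    have /rV0Pn[i ui] := u0; exists (enum_val i).
    by rewrite enum_valK mulf_neq0 ?invr_eq0.
  move=> v; have := coef u (fun v => u 0 (enum_rank v) / c v) uE (enum_rank v).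
  rewrite uM mxE enum_rankK => /esym/eqP; rewrite !mulf_eq0 (negbTE s0) (negbTE (c0 v)) /=.
  by rewrite subr_eq0 => /eqP.
move=> [f [[v fv] fE]].
exists (\row_i (c (enum_val i) * f (enum_val i))).
  by apply/rV0Pn; exists (enum_rank v); rewrite mxE enum_rankK mulf_neq0.
apply/rowP => j; rewrite (coef _ f) ?mxE ?fE ?subrr ?mulr0 // => i.
by rewrite mxE.
Qed.

(* [d] is a depth function of a rooted forest, and [c] exists because a forest
   has no cycle around which the prescribed ratios could be inconsistent. *)
Lemma forest_scaling (K : fieldType) (T : finType) (e lt : rel T)
    (d : T -> nat) (s : K) :
    symmetric e -> s != 0 ->
    (forall v w, e v w -> d w = (d v).+1 \/ d v = (d w).+1) ->
    (forall u v w, e u w -> e v w -> d w = (d u).+1 -> d w = (d v).+1 -> u = v) ->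
    (forall v w, lt v w -> ~~ lt w v) ->
  exists2 c : T -> K, forall v, c v != 0 &
    forall v w, e v w -> lt v w -> c w = s * c v.
Proof.
move=> e_sym s0 ed euniq ltA.
have [N Nd] : exists N, forall v, (d v <= N)%N.
  by exists (\max_v d v) => v; exact: leq_bigmax.
suff [c c0 cE] : exists2 c : T -> K, forall v, c v != 0 &
    forall v w, e v w -> lt v w -> (d v <= N)%N -> (d w <= N)%N -> c w = s * c v.
  by exists c => // v w evw lvw; apply: cE.
elim: N {Nd} => [|N [c c0 cE]].
  exists (fun=> 1) => [v|v w /ed[]]; first exact: oner_neq0.
    by move=> -> _ _; rewrite ltn0.
  by move=> -> _; rewrite ltn0.
(* [r w v] is the value forced on a child [w] by its parent [v]. The scaling is extended one depth
   at a time; a vertex of depth [N.+1] without a parent gets 1. *)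
pose r w v := if lt v w then s * c v else if lt w v then s^-1 * c v else c v.
pose c' w := if d w == N.+1 then
  if [pick v | e v w & d v == N] is Some v then r w v else 1 else c w.
have c'N w v : e v w -> d v = N -> d w = N.+1 -> c' w = r w v.
  move=> evw dv dw; rewrite /c' dw eqxx; case: pickP => [u /andP[euw /eqP du]|].
    by congr (r w _); apply: (euniq _ _ w) => //; rewrite dw ?du ?dv.
  by move/(_ v); rewrite evw dv eqxx.
have c'c w : (d w <= N)%N -> c' w = c w.
  by move=> dw; rewrite /c' ltn_eqF.
exists c' => [w|v w evw lvw].
  rewrite /c'; case: ifP => // _; case: pickP => [v _|_]; last exact: oner_neq0.
  by rewrite /r; do 2?case: ifP => _; rewrite ?mulf_neq0 ?invr_eq0.
rewrite leq_eqVlt ltnS => /orP[/eqP dv|dv];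
  rewrite leq_eqVlt ltnS => /orP[/eqP dw|dw].
- by case: (ed _ _ evw); rewrite dv dw; lia.
- have dw' : d w = N by case: (ed _ _ evw); rewrite dv; lia.
  rewrite (c'N v w) // 1?e_sym // c'c // /r lvw (negbTE (ltA _ _ lvw)).
  by rewrite mulVKf.
- have dv' : d v = N by case: (ed _ _ evw); rewrite dw; lia.
  by rewrite (c'N w v) // c'c // /r lvw.
- by rewrite !c'c //; apply: cE.
Qed.

(** * Spectral radius *)

(** Write [f = a + i b]. By symmetry the pairings of [a] with [A b] and of [b] with [A a] agree,
    while their difference is [Im x] times the squared norm of [f]. Once [Im x = 0], both [a] and
    [b] satisfy the equation and one of them is nonzero. *)
Lemma graph_eigenvector_real (R : realType) (T : finType) (e : rel T)
    (x : R[i]) (f : T -> R[i]) :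
    symmetric e -> graph_eigenvector e x f ->
  complex.Im x = 0 /\ exists g : T -> R, graph_eigenvector e (complex.Re x) g.
Proof.
move=> e_sym [[v0 fv0] fE].
pose a v := complex.Re (f v); pose b v := complex.Im (f v).
have aE v : \sum_(w | e v w) a w = complex.Re x * a v - complex.Im x * b v.
  have := congr1 (@complex.Re R) (fE v).
  rewrite (big_morph (@complex.Re R) (id1 := 0) (op1 := +%R)) //.
    by move=> ->; rewrite /a /b; case: (x) (f v) => [? ?] [].
  by move=> [? ?] [].
have bE v : \sum_(w | e v w) b w = complex.Re x * b v + complex.Im x * a v.
  have := congr1 (@complex.Im R) (fE v).
  rewrite (big_morph (@complex.Im R) (id1 := 0) (op1 := +%R)) //.
    by move=> ->; rewrite /a /b; case: (x) (f v) => [? ?] [].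
  by move=> [? ?] [].
have ab0 : 0 < \sum_v (a v ^+ 2 + b v ^+ 2).
  rewrite (bigD1 v0) //= ltr_pwDl //; last first.
    by apply: sumr_ge0 => v _; rewrite addr_ge0 ?sqr_ge0.
  rewrite lt0r addr_ge0 ?sqr_ge0 // andbT paddr_eq0 ?sqr_ge0 // !sqrf_eq0.
  by move: fv0; rewrite eq_complex.
have Im0 : complex.Im x = 0.
  apply/eqP; rewrite -(mulIr_eq0 _ (mulIf (lt0r_neq0 ab0))).
  have E : \sum_v b v * (\sum_(w | e v w) a w) = \sum_v a v * (\sum_(w | e v w) b w).
    under eq_bigr do rewrite mulr_sumr.
    under [RHS]eq_bigr do rewrite mulr_sumr.
    rewrite (exchange_big_dep predT) //=; apply: eq_bigr => v _.
    by apply: eq_big => [w|w _]; [rewrite e_sym | rewrite mulrC].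
  move/eqP: E; rewrite eq_sym -subr_eq0 -sumrB => /eqP E.
  apply/eqP; rewrite -[RHS]E mulr_sumr; apply: eq_bigr => v _.
  by rewrite aE bE; ring.
split=> //.
have [av0|av0] := eqVneq (a v0) 0; last first.
  by exists a; split=> [|v]; [exists v0 | rewrite aE Im0; ring].
exists b; split=> [|v]; last by rewrite bE Im0; ring.
exists v0; apply: contra_neq fv0 => bv0; apply/eqP.
by rewrite eq_complex; apply/andP; split; apply/eqP.
Qed.

(** A Collatz-Wielandt bound: evaluate the eigenvalue equation at a vertex where [|f| / g] is
    maximal. *)
Lemma supersolution_bound (R : realType) (T : finType) (e : rel T)
    (x y : R) (f g : T -> R) :
    graph_eigenvector e x f -> (forall v, 0 < g v) ->
    (forall v, \sum_(w | e v w) g w <= y * g v) ->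
  `|x| <= y.
Proof.
move=> [[v0 fv0] fE] g0 gE.
case: (arg_maxP (fun v => `|f v| / g v) (erefl : predT v0)) => v _ vmax.
have fle w : `|f w| <= `|f v| / g v * g w.
  by rewrite -ler_pdivrMr //; exact: vmax.
have fv : 0 < `|f v|.
  have : 0 < `|f v| / g v by apply: (lt_le_trans _ (vmax v0 isT)); rewrite divr_gt0 ?normr_gt0.
  by rewrite pmulr_lgt0 ?invr_gt0.
rewrite -(ler_pM2r fv) -normrM -fE.
apply: le_trans (ler_norm_sum _ _ _) _.
apply: le_trans (ler_sum _ (fun w _ => fle w)) _.
have gv := g0 v.
rewrite -mulr_sumr; apply: le_trans (ler_wpM2l _ (gE v)) _.
  by rewrite divr_ge0 // ltW.
by rewrite mulrCA divfK ?gt_eqF.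
Qed.

(** Acyclicity is certified by a depth function: a deepest vertex of a cycle would have two distinct
    neighbours of smaller depth, which the last clause forbids. *)
Definition rooted_forest (T : finType) (e : rel T) (d : T -> nat) : Prop :=
  [/\ symmetric e, irreflexive e,
      forall v w, e v w -> d w = (d v).+1 \/ d v = (d w).+1 &
      forall u v w, e u w -> e v w ->
        d w = (d u).+1 -> d w = (d v).+1 -> u = v].

Lemma root_cox_forest (K : fieldType) (T : finType) (e : rel T) (d : T -> nat)
    (s : K) :
    rooted_forest e d -> s != 0 ->
  root (map_poly intr (cox e)) (s ^+ 2) <->
  exists f : T -> K, graph_eigenvector e (s + s^-1) f.
Proof.
move=> [e_sym eirr ed euniq] s0.
have [|c c0 cE] := @forest_scaling K T e
  (fun v w => (enum_rank v < enum_rank w)%N) d s e_sym s0 ed euniq.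
  by move=> v w; rewrite -leqNgt => /ltnW.
exact: root_cox cE.
Qed.

Lemma cox0_neq0 (K : fieldType) (T : finType) (e : rel T) :
  irreflexive e -> ~~ root (map_poly intr (cox e) : {poly K}) 0.
Proof.
move=> eirr; apply/negP => /root_char_coxeter[|u u0].
  by move=> i; rewrite mxE eirr.
rewrite scale0r add0r => /(congr1 (mulmxr (invmx (map_mx intr (lower_mx (adjacency_mx e)))))).
rewrite /= mulmxK ?mul0mx => [/eqP|]; first by rewrite (negbTE u0).
by rewrite unitmxE det_map_mx det_lower_mx rmorph1 unitr1.
Qed.

Lemma mem_complex_roots (R : realType) (f : {poly int}) (z : R[i]) : f \is monic ->
  (z \in complex_roots R f) = root (map_poly intr f) z.
Proof.
move=> /monicP fm; rewrite /complex_roots; case: closed_field_poly_normal => r /= ->.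
by rewrite lead_coef_map_inj ?fm ?rmorph1 ?scale1r ?root_prod_XsubC //; apply: intr_inj.
Qed.

Section Rho.
Variables (R : realType) (T : finType) (e : rel T) (d : T -> nat).
Hypothesis forest : rooted_forest e d.

Lemma normc_le_rho (z : R[i]) :
  root (map_poly intr (cox e)) z -> Normc.normc z <= rho R (cox e).
Proof.
rewrite -mem_complex_roots ?cox_monic // => zr.
exact: (le_bigmax_seq 0 z xpredT (@Normc.normc R)).
Qed.

Lemma rho_ge_eigenvalue (s : R) (f : T -> R) :
  1 < s -> graph_eigenvector e (s + s^-1) f -> s ^+ 2 <= rho R (cox e).
Proof.
move=> s1 [[v fv] fE].
have s0 : s != 0 by rewrite gt_eqF // (lt_trans ltr01).
have sC0 : (s%:C)%C != 0 by rewrite eq_complex /= eqxx andbT.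
have : root (map_poly intr (cox e)) ((s%:C)%C ^+ 2).
  apply/(root_cox_forest forest sC0); exists (fun v => (f v)%:C)%C; split.
    by exists v; rewrite eq_complex /= eqxx andbT.
  by move=> w; rewrite -rmorph_sum fE !rmorphM /= rmorphD /= fmorphV.
move/normc_le_rho; rewrite -rmorphXn /= /Normc.normc expr0n addr0 sqrtr_sqr.
by rewrite ger0_norm // sqr_ge0.
Qed.

(* If [z] is a root then so is [1/z], and one of the two lies outside the open
   unit disk. *)
Lemma rho_ge1 : (0 < #|T|)%N -> 1 <= rho R (cox e).
Proof.
move=> T0.
have [|z zr] := closed_rootP (map_poly intr (cox e) : {poly R[i]}) _.
  by rewrite size_map_inj_poly ?size_cox ?eqSS -?lt0n ?T0 //; apply: intr_inj.
have z0 : z != 0.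
  apply: contraTneq zr => ->; apply: cox0_neq0.
  by case: forest.
have s0 : sqrtc z != 0 by rewrite sqrtc_eq0.
(* With [z = t^2], the eigenvalue [t + 1/t] is invariant under [t -> 1/t]. *)
have zVr : root (map_poly intr (cox e)) z^-1.
  move: zr; rewrite -{1}(sqr_sqrtc z) => /(root_cox_forest forest s0)[f fE].
  rewrite -{1}(sqr_sqrtc z) -exprVn; apply/(root_cox_forest forest).
    by rewrite invr_eq0.
  by exists f; rewrite invrK addrC.
have nz0 : 0 < Normc.normc z.
  rewrite lt0r; apply/andP; split.
    by apply: contra_neq z0 => /Normc.eq0_normc.
  by case: (z) => a b; apply: sqrtr_ge0.
have := normc_le_rho zr; have := normc_le_rho zVr.
rewrite Normc.normcV; have [|z1] := leP 1 (Normc.normc z).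
  by move=> h _; apply: le_trans.
by move=> h _; apply: le_trans h; rewrite invf_ge1 // ltW.
Qed.

(** Write a root as [t^2] with [t = a + i b] and [D = |t|^2]. Realness of [t + 1/t] means
    [b (1 - 1/D) = 0], so either [D = 1], which is below [s^2], or [t] is real. In the real case
    [supersolution_bound] gives [|a| + 1/|a| <= s + 1/s]. *)
Lemma rho_le_supersolution (s : R) (g : T -> R) :
    1 < s -> (forall v, 0 < g v) ->
    (forall v, \sum_(w | e v w) g w <= (s + s^-1) * g v) ->
  rho R (cox e) <= s ^+ 2.
Proof.
move=> s1 g0 gE; have s0 : 0 < s by apply: lt_trans s1.
rewrite /rho big_seq; apply: bigmax_le; first exact: sqr_ge0.
move=> z; rewrite mem_complex_roots ?cox_monic // => zr.
have [->|z0] := eqVneq z 0; first by rewrite Normc.normc0 sqr_ge0.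
have t0 : sqrtc z != 0 by rewrite sqrtc_eq0.
move: zr; rewrite -(sqr_sqrtc z) => /(root_cox_forest forest t0)[f fE].
have [e_sym _ _ _] := forest.
have [] := graph_eigenvector_real e_sym fE.
move: (sqrtc z) t0 => [a b] t0 {z z0 f fE} Im0 [f fE].
have := supersolution_bound fE g0 gE.
move: Im0; rewrite expr2 Normc.normcM -expr2 /=.
set D := a ^+ 2 + b ^+ 2 => Im0 Re_le.
have D0 : 0 <= D by rewrite addr_ge0 ?sqr_ge0.
rewrite sqr_sqrtr //.
have [D1|D1] := leP D 1; first by rewrite (le_trans D1) // expr_ge1 // ltW.
have b0 : b = 0.
  have /eqP : b * (D - 1) = 0.
    have Dn0 : D != 0 by rewrite gt_eqF // (lt_trans ltr01).
    have -> : b * (D - 1) = D * (b + - (b / D)) by field.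
    by rewrite Im0 mulr0.
  by rewrite mulf_eq0 subr_eq0 (gt_eqF D1) orbF => /eqP.
have a0 : a != 0.
  by move: t0; rewrite eq_complex /= b0 eqxx andbT.
move: Re_le; have -> : D = a ^+ 2 by rewrite /D b0 expr0n addr0.
have -> : a + a / a ^+ 2 = (a ^+ 2 + 1) / a by field.
rewrite normrM normfV (ger0_norm (x := _ + 1)) ?addr_ge0 ?sqr_ge0 //.
rewrite ler_pdivrMr ?normr_gt0 // -real_normK ?num_real //.
have : 1 < `|a| by move: D1; rewrite /D b0 expr0n addr0 -real_normK ?num_real // expr_gt1.
move: `|a| => A A1.
rewrite -subr_ge0.
(* The factor [A - s^-1] is positive because [s^-1 < 1 < A], so the sign is that of [s - A]. *)
have -> : (s + s^-1) * A - (A ^+ 2 + 1) = (A - s^-1) * (s - A) by field; rewrite gt_eqF.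
rewrite pmulr_rge0 ?subr_ge0 => [As|]; first by rewrite ler_sqr ?nnegrE // ltW // (lt_trans ltr01).
by rewrite subr_gt0 (lt_trans _ A1) // invf_lt1.
Qed.

End Rho.

(** * Hyperbolic ratios *)

(* Up to normalization, [sinh (m log s)] for [eps = -1] and [cosh (m log s)]
   for [eps = 1]. *)
Definition hyp (R : realType) (eps : R) (m : nat) (s : R) : R :=
  s ^+ m + eps * s^-1 ^+ m.

Definition hyp_ratio (R : realType) (eps : R) (m : nat) (s : R) : R :=
  hyp eps m s / hyp eps m.+1 s.

Lemma lerN11 (R : numDomainType) : -1 <= 1 :> R.
Proof. exact: le_trans (lerN10 _) ler01. Qed.

Section Hyp.
Variables (R : realType) (eps : R).
Hypothesis (epsN1 : -1 <= eps) (eps1 : eps <= 1).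
Implicit Types (s t : R) (m : nat).

Lemma addrV_lt s t : 1 < s -> s < t -> s + s^-1 < t + t^-1.
Proof.
move=> s1 st; have s0 : 0 < s by apply: lt_trans s1.
have t0 : 0 < t by apply: lt_trans st.
rewrite -subr_gt0.
have -> : t + t^-1 - (s + s^-1) = (t - s) * (1 - (s * t)^-1).
  by field; rewrite !gt_eqF.
rewrite mulr_gt0 ?subr_gt0 // invf_lt1 ?mulr_gt0 //.
by rewrite mulr_egt1 // (lt_trans s1).
Qed.

(** This recurrence is the eigenvalue equation at an interior vertex of a path. *)
Lemma hypSS m s : s != 0 ->
  hyp eps m.+2 s = (s + s^-1) * hyp eps m.+1 s - hyp eps m s.
Proof. by move=> s0; rewrite /hyp !exprS; field. Qed.

Lemma hyp_ltS m s : 1 < s -> hyp eps m s < hyp eps m.+1 s.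
Proof.
move=> s1; have s0 : 0 < s by apply: lt_trans s1.
rewrite -subr_gt0 /hyp !exprS.
have -> : s * s ^+ m + eps * (s^-1 * s^-1 ^+ m) - (s ^+ m + eps * s^-1 ^+ m) =
   (s - 1) * (s ^+ m - eps * s^-1 ^+ m.+1) by rewrite !exprS; field; rewrite gt_eqF.
rewrite mulr_gt0 ?subr_gt0 //.
have V1 : s^-1 ^+ m.+1 < 1 by rewrite exprn_ilt1 ?invr_ge0 ?(ltW s0) // invf_lt1.
have V0 : 0 <= s^-1 ^+ m.+1 by rewrite exprn_ge0 // invr_ge0 ltW.
have := exprn_ege1 m (ltW s1).
have := ler_piMl V0 eps1.
lra.
Qed.

Lemma hyp_ge0 m s : 1 < s -> 0 <= hyp eps m s.
Proof.
move=> s1; elim: m => [|m /le_lt_trans IH]; last by apply/ltW/IH/hyp_ltS.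
by rewrite /hyp !expr0 mulr1 -lerBlDl sub0r.
Qed.

Lemma hypS_gt0 m s : 1 < s -> 0 < hyp eps m.+1 s.
Proof. by move=> s1; apply: le_lt_trans (hyp_ltS m s1); apply: hyp_ge0. Qed.

Lemma hyp_ratio_le1 m s : 1 < s -> hyp_ratio eps m s <= 1.
Proof. by move=> s1; rewrite ler_pdivrMr ?hypS_gt0 // mul1r ltW // hyp_ltS. Qed.

Lemma hyp_ratioS m s : 1 < s ->
  hyp_ratio eps m.+1 s = (s + s^-1 - hyp_ratio eps m s)^-1.
Proof.
move=> s1; have s0 : s != 0 by rewrite gt_eqF // (lt_trans ltr01).
have h1 := hypS_gt0 m s1; have := hypS_gt0 m.+1 s1.
rewrite /hyp_ratio hypSS // => h2.
rewrite -[LHS]invrK invf_div mulrBl mulfK ?gt_eqF //.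
Qed.

(** Induction on [m] through [hyp_ratioS]: in [1 / (s + 1/s - r)] the term [s + 1/s] increases and
    the previous ratio [r] does not. At [m = 0] the ratio is [(1 + eps) / (s + eps / s)], whose
    denominator is nondecreasing as [eps <= 1]. *)
Lemma hyp_ratio_nonincreasing m s t : 1 < s -> s <= t ->
  hyp_ratio eps m t <= hyp_ratio eps m s.
Proof.
move=> s1; rewrite le_eqVlt => /orP[/eqP->//|st].
have t1 : 1 < t by apply: lt_trans st.
elim: m => [|m IH].
  have s0 : 0 < s by apply: lt_trans s1.
  have t0 : 0 < t by apply: lt_trans st.
  rewrite /hyp_ratio {1 3}/hyp !expr0 mulr1.
  apply: ler_wpM2l; first by rewrite -lerBlDl sub0r.
  rewrite lef_pV2 ?posrE ?hypS_gt0 // /hyp !expr1.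
  rewrite -subr_ge0.
  have -> : t + eps / t - (s + eps / s) = (t - s) * (1 - eps * (s * t)^-1).
    by field; rewrite !gt_eqF.
  rewrite mulr_ge0 ?subr_ge0 ?(ltW st) //.
  have V1 : (s * t)^-1 < 1 by rewrite invf_lt1 ?mulr_gt0 // mulr_egt1.
  have V0 : 0 < (s * t)^-1 by rewrite invr_gt0 mulr_gt0.
  by have := ler_piMl (ltW V0) eps1; lra.
rewrite !hyp_ratioS // lef_pV2 ?posrE; last 2 first.
- by rewrite -invr_gt0 -hyp_ratioS // divr_gt0 ?hypS_gt0.
- by rewrite -invr_gt0 -hyp_ratioS // divr_gt0 ?hypS_gt0.
by have := addrV_lt s1 st; lra.
Qed.

Lemma hyp_ratio_cvg s : 1 < s -> hyp_ratio eps m s @[m --> \oo] --> s^-1.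
Proof.
move=> s1; have s0 : 0 < s by apply: lt_trans s1.
(* Pulling out the dominant powers of [s] leaves geometric terms in [s^-2], which vanish in the
   limit. *)
have E m : hyp_ratio eps m s =
    (1 + eps * (s^-1 ^+ 2) ^+ m) * (s * (1 + eps * (s^-1 ^+ 2) ^+ m.+1))^-1.
  have sm : s ^+ m != 0 by rewrite expf_neq0 // gt_eqF.
  have E1 k : hyp eps k s = s ^+ k * (1 + eps * (s^-1 ^+ 2) ^+ k).
    rewrite /hyp mulrDr mulr1; congr (_ + _).
    by rewrite -exprM mulnC exprM expr2 !exprVn; field; rewrite expf_neq0 // gt_eqF.
  have := hypS_gt0 m s1.
  rewrite /hyp_ratio !E1 (exprS s) => h.
  have : 1 + eps * (s^-1 ^+ 2) ^+ m.+1 != 0.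
    by apply: contraTneq h => ->; rewrite mulr0 ltxx.
  by move=> h'; field; rewrite h' sm gt_eqF.
under eq_fun do rewrite E.
have g : (s^-1 ^+ 2) ^+ m @[m --> \oo] --> (0 : R).
  apply: cvg_expr; rewrite ger0_norm ?sqr_ge0 //.
  by rewrite exprn_ilt1 ?invr_ge0 ?(ltW s0) // invf_lt1.
have h : (1 + eps * (s^-1 ^+ 2) ^+ m) @[m --> \oo] --> 1 + eps * 0.
  by apply: cvgD; [exact: cvg_cst | apply: cvgMl_tmp].
rewrite mulr0 addr0 in h.
have h' : s * (1 + eps * (s^-1 ^+ 2) ^+ m.+1) @[m --> \oo] --> s * 1.
  by apply: cvgMl_tmp; move: h; rewrite -cvg_shiftS.
rewrite mulr1 in h'.
have h'' : (s * (1 + eps * (s^-1 ^+ 2) ^+ m.+1))^-1 @[m --> \oo] --> s^-1.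
  by apply: cvgV => //; rewrite gt_eqF.
have h3 : _ @[m --> \oo] --> 1 * s^-1 := cvgM h h''.
by rewrite mul1r in h3; exact: h3.
Qed.

Lemma hyp_ratio_continuous m s : 1 < s -> {for s, continuous (hyp_ratio eps m)}.
Proof.
move=> s1; have s0 : s != 0 by rewrite gt_eqF // (lt_trans ltr01).
have hypC k : {for s, continuous (hyp eps k)}.
  have X := @exprn_continuous R k.
  have V : {for s, continuous ((fun x : R => x ^+ k) \o GRing.inv)}.
    by apply: continuous_comp; [exact: inv_continuous | exact: X].
  apply: continuousD; first exact: X.
  by apply: continuousM; [exact: cst_continuous | exact: V].
apply: continuousM => //; apply: continuousV => //.
by rewrite gt_eqF ?hypS_gt0.
Qed.

End Hyp.

(** * The threshold and its limits *)

(** Adjoining 1 makes the set nonempty and gives the value 1 when no [s > 1] qualifies. *)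
Definition threshold (R : realType) (H : R -> R) : R :=
  sup [set s | s = 1 \/ (1 < s /\ s + s^-1 <= H s)].

(** Monotonicity makes [H s] cross the increasing function [s + 1/s] at most once; the upper bound
    keeps the supremum finite. *)
Definition admissible (R : realType) (H : R -> R) : Prop :=
  (forall s t, 1 < s -> s <= t -> H t <= H s) /\
  exists M, forall s, 1 < s -> H s <= M.

Section Threshold.
Variable R : realType.
Implicit Types (H P : R -> R) (s t : R).

Lemma admissibleD H P :
  admissible H -> admissible P -> admissible (fun s => H s + P s).
Proof.
move=> [Hn [M HM]] [Pn [N PN]]; split=> [s t s1 st|].
  by rewrite lerD ?Hn ?Pn.
by exists (M + N) => s s1; rewrite lerD ?HM ?PN.
Qed.

Lemma admissible_hyp_ratio eps m : -1 <= eps -> eps <= 1 ->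
  admissible (hyp_ratio eps m : R -> R).
Proof.
move=> e1 e2; split=> [s t|]; first exact: hyp_ratio_nonincreasing.
by exists 1 => s; apply: hyp_ratio_le1.
Qed.

Lemma admissible_natV n : admissible (fun s : R => n%:R / s).
Proof.
split=> [s t s1 st|].
  rewrite ler_wpM2l // lef_pV2 ?posrE // (lt_le_trans ltr01) // ltW //.
  exact: lt_le_trans st.
exists n%:R => s s1; rewrite ler_piMr // invf_le1 ?ltW //.
exact: lt_trans s1.
Qed.

Lemma threshold_has_ubound H : admissible H ->
  has_ubound [set s | s = 1 \/ (1 < s /\ s + s^-1 <= H s)].
Proof.
move=> [_ [M HM]]; exists (Num.max 1 M) => s /= [->|[s1 sH]].
  by rewrite le_max lexx.
rewrite le_max; apply/orP; right; apply: le_trans (HM s s1).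
apply: le_trans sH; rewrite lerDl invr_ge0 ltW //.
exact: lt_trans s1.
Qed.

Lemma threshold_ge1 H : admissible H -> 1 <= threshold H.
Proof. by move=> /threshold_has_ubound/ub_le_sup; apply; left. Qed.

Lemma threshold_ge H s : admissible H -> 1 < s -> s + s^-1 <= H s ->
  s <= threshold H.
Proof. by move=> /threshold_has_ubound/ub_le_sup + s1 sH; apply; right. Qed.

Lemma threshold_gt H s : admissible H -> threshold H < s -> H s < s + s^-1.
Proof.
move=> aH; rewrite !ltNge; apply: contra => sH.
have [s1|s1] := ltP 1 s; first exact: threshold_ge.
exact: le_trans (threshold_ge1 aH).
Qed.

Lemma threshold_le H s : admissible H -> 1 <= s ->
  (forall t, s < t -> H t < t + t^-1) -> threshold H <= s.
Proof.
move=> aH s1 sH; apply: ge_sup; first by exists 1; left.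
move=> t /= [->//|[t1 tH]]; rewrite leNgt; apply/negP => /sH.
by rewrite ltNge tH.
Qed.

Lemma threshold_le_lt H s : admissible H -> 1 < s -> H s < s + s^-1 ->
  threshold H <= s.
Proof.
move=> aH s1 sH; apply: threshold_le; [by []|exact: ltW|move=> t st].
by apply: le_lt_trans (aH.1 _ _ s1 (ltW st)) (lt_trans sH _); apply: addrV_lt.
Qed.

Lemma threshold_lt H s : admissible H -> 1 < s -> s < threshold H ->
  s + s^-1 < H s.
Proof.
move=> aH s1 sT.
have [t [t1|[t1 tH]] st] := sup_gt (ex_intro _ 1 (or_introl (erefl _))) sT.
  by move: (lt_trans s1 st); rewrite t1 ltxx.
by apply: lt_le_trans (addrV_lt s1 st) (le_trans tH (aH.1 _ _ s1 (ltW st))).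
Qed.

(** By the single crossing, comparing both sides at one point [s > 1] locates the threshold relative
    to [s]. Hence pointwise convergence at the two points [T + eps] and [T - eps] suffices. *)
Lemma threshold_cvg H P (p : nat -> R -> R) :
    admissible H -> admissible P -> (forall n, admissible (p n)) ->
    (forall s, 1 < s -> p n s @[n --> \oo] --> P s) ->
  threshold (fun s => H s + p n s) @[n --> \oo] --> threshold (fun s => H s + P s).
Proof.
move=> aH aP ap pP; set T := threshold (fun s => H s + P s).
have aHP := admissibleD aH aP; have aHp n := admissibleD aH (ap n).
have T1 : 1 <= T := threshold_ge1 aHP.
apply/cvgrPdist_le => eps eps0.
have near_le : \forall n \near \oo, threshold (fun s => H s + p n s) <= T + eps.
  have s1 : 1 < T + eps by rewrite ltr_pwDr.
  have /(threshold_gt aHP) sHP : T < T + eps by rewrite ltrDl.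
  have : \forall n \near \oo, p n (T + eps) < T + eps + (T + eps)^-1 - H (T + eps).
    by apply: (cvgr_lt _ (pP _ s1)); rewrite ltrBrDl.
  by apply: filterS => n; rewrite ltrBrDl; exact: (threshold_le_lt (aHp n) s1).
have near_ge : \forall n \near \oo, T - eps <= threshold (fun s => H s + p n s).
  (* If [T - eps <= 1], the lower bound holds because every threshold is at least 1. *)
  have [s1|s1] := ltP 1 (T - eps); last first.
    by apply: nearW => n; apply: le_trans s1 (threshold_ge1 (aHp n)).
  have /(threshold_lt aHP s1) sHP : T - eps < T by rewrite ltrBlDr ltrDl.
  have : \forall n \near \oo, T - eps + (T - eps)^-1 - H (T - eps) < p n (T - eps).
    by apply: (cvgr_gt _ (pP _ s1)); rewrite ltrBlDl.
  by apply: filterS => n; rewrite ltrBlDl => /ltW; exact: (threshold_ge (aHp n) s1).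
near=> n; rewrite ler_distlC; apply/andP; split.
  by near: n.
by near: n.
Unshelve. all: by end_near. Qed.

Lemma threshold_natV n : (2 <= n)%N ->
  threshold (fun s : R => n%:R / s) ^+ 2 = n%:R - 1.
Proof.
move=> n2; have aH := admissible_natV n.
have n1 : 1 <= n%:R - 1 :> R by rewrite lerBrDr -[1 + 1]/(2%:R) ler_nat.
have E s : 0 < s -> (s + s^-1 <= n%:R / s) = (s ^+ 2 <= n%:R - 1).
  move=> s0; rewrite ler_pdivlMr // mulrDl mulVf ?gt_eqF //.
  by rewrite -lerBrDr expr2.
suff -> : threshold (fun s : R => n%:R / s) = Num.sqrt (n%:R - 1).
  by rewrite sqr_sqrtr // (le_trans ler01).
apply/eqP; rewrite eq_le; apply/andP; split.
  apply: threshold_le => // [|t].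
    by rewrite -[leLHS]sqrtr1 ler_wsqrtr.
  move=> st; have t0 : 0 < t by apply: le_lt_trans st; apply: sqrtr_ge0.
  rewrite ltNge E // -ltNge.
  rewrite -(sqr_sqrtr (le_trans ler01 n1)) ltr_sqr ?nnegrE ?sqrtr_ge0 //.
  exact: ltW.
(* For [n = 2] the square root is 1, and the adjoined element 1 provides the bound. *)
have [s1|s1] := ltP 1 (Num.sqrt (n%:R - 1 : R)); last first.
  exact: le_trans (threshold_ge1 aH).
apply: threshold_ge => //; rewrite E ?sqr_sqrtr ?(le_trans ler01) //.
exact: lt_trans s1.
Qed.

(** * Iterated limits of thresholds *)

(** Agreement is required only above the lower bounds [m], since the trees with D branches are
    analysed only for parameters at least 3. *)
Lemma is_iterated_lim_ext (m : seq nat) (f g : seq nat -> R) (l : R) :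
    (forall p, size p = size m -> (forall j, (nth 0 m j <= nth 0 p j)%N) ->
       f p = g p) ->
  is_iterated_lim m f l -> is_iterated_lim m g l.
Proof.
elim: m f g l => [|m1 m IH] f g l fg /=; first by rewrite fg // => j; rewrite nth_nil.
move=> [h fh hl]; exists h => // p1 mp1; apply: IH (fh p1 mp1) => p sp mp.
by rewrite fg //= ?sp // => -[|j] //=.
Qed.

(** [true] marks a D branch. An A branch with [p = 0] has ratio 0, in accordance with the empty
    diagram. *)
Definition branch_ratio (b : bool) (p : nat) : R -> R :=
  if b then hyp_ratio 1 (p - 2) else hyp_ratio (-1) p.

Lemma admissible_branch b p : admissible (branch_ratio b p).
Proof.
have N11 := lerN11 R.
by case: b; apply: admissible_hyp_ratio.
Qed.

Lemma branch_ratio_cvg b s : 1 < s ->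
  branch_ratio b p s @[p --> \oo] --> s^-1.
Proof.
move=> s1.
have N11 := lerN11 R.
case: b; last exact: hyp_ratio_cvg.
have := @hyp_ratio_cvg R 1 N11 (lexx _) s s1.
by rewrite -(cvg_centern 2).
Qed.

(** Induction on the number of variables, with [H] collecting the branches whose parameter is
    already fixed. The inner limits replace each later ratio by [1/s]; the outer one is then
    [threshold_cvg] in [p1]. *)
Lemma threshold_iterated_lim (m : seq nat) (b : nat -> bool) (H : R -> R) :
    admissible H ->
  is_iterated_lim m
    (fun p => threshold (fun s =>
       H s + \sum_(j < size p) branch_ratio (b j) (nth 0%N p j) s) ^+ 2)
    (threshold (fun s => H s + (size m)%:R / s) ^+ 2).
Proof.
elim: m b H => [|m1 m IH] b H aH /=.
  by congr (threshold _ ^+ 2); apply/funext => s; rewrite big_ord0 mul0r.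
exists (fun p1 => threshold (fun s =>
    (H s + (size m)%:R / s) + branch_ratio (b 0%N) p1 s) ^+ 2).
  move=> p1 _; have := IH (b \o succn) _ (admissibleD aH (admissible_branch (b 0%N) p1)).
  set l := threshold _; set l' := threshold _.
  have -> : l = l'.
    by congr threshold; apply/funext => s; rewrite addrAC.
  apply: is_iterated_lim_ext => p _ _; congr (threshold _ ^+ 2).
  by apply/funext => s; rewrite /= big_ord_recl /= addrA.
have -> : (fun s => H s + (size m).+1%:R / s) =
          (fun s => (H s + (size m)%:R / s) + s^-1).
  by apply/funext => s; rewrite -addrA -natr1 mulrDl mul1r.
have aV : admissible (fun s : R => s^-1).
  by have := admissible_natV 1; under eq_fun do rewrite div1r.
have aHm := admissibleD aH (admissible_natV (size m)).
have cT := threshold_cvg aHm aV (admissible_branch (b 0%N))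
  (@branch_ratio_cvg (b 0%N)).
by rewrite expr2; apply: cvgM.
Qed.

End Threshold.

(** * Eigenvectors on the star-like trees *)

Lemma big_option (R : Type) (idx : R) (op : Monoid.com_law idx) (T : finType)
    (P : pred (option T)) (F : option T -> R) :
  \big[op/idx]_(x | P x) F x =
  op (if P None then F None else idx) (\big[op/idx]_(y | P (Some y)) F (Some y)).
Proof.
rewrite big_mkcond (bigD1 None) //= -big_mkcondr; congr (op _ _).
rewrite (reindex_omap Some id) //=; last by case.
by apply: eq_bigl => y; rewrite eqxx andbT.
Qed.

Lemma sum_orb (V : nmodType) (T : finType) (P Q : pred T) (F : T -> V) :
    (forall x, P x -> ~~ Q x) ->
  \sum_(x | P x || Q x) F x = \sum_(x | P x) F x + \sum_(x | Q x) F x.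
Proof.
move=> PQ; rewrite (big_mkcond P) (big_mkcond Q) [LHS]big_mkcond -big_split /=.
apply: eq_bigr => x _; case: (boolP (P x)) => [/PQ/negbTE->|_] /=.
  by rewrite addr0.
by rewrite add0r.
Qed.

Section Join.
Variables (I : finType) (V : I -> finType) (E : forall i, rel (V i)).
Variable b : forall i, option (V i).

(** The new vertex becomes a root and the depths in the branches go up by one. An attachment vertex
    had depth 0, hence no parent in its branch, so the new vertex is its only parent. *)
Lemma join_rooted_forest (d : forall i, V i -> nat) :
    (forall i, rooted_forest (@E i) (@d i)) ->
    (forall i v, b i = Some v -> d i v = 0%N) ->
  rooted_forest (join_rel E b)
    (fun x => if x is Some u then (d (tag u) (tagged u)).+1 else 0%N).
Proof.
move=> dE db; split.
- move=> [[i v]|] [[j w]|] //=; case: eqVneq => [ij|//] /=.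
  move: w; rewrite -ij => w; rewrite !tagged_asE.
  by case: (dE i) => + _ _ _; apply.
- move=> [[i v]|] //=; rewrite eqxx tagged_asE.
  by case: (dE i) => _ + _ _; apply.
- move=> [[i v]|] [[j w]|] //=; [|by move/eqP/db->; right|by move/eqP/db->; left].
  move/andP=> [/eqP ij]; move: w; rewrite -ij => w; rewrite tagged_asE.
  by case: (dE i) => _ _ + _ => /[apply] -[]->; [left|right].
move=> [[i v]|] [[j w]|] [[l u]|] //=.
- move=> /andP[/eqP il] + /andP[/eqP jl].
  move: v w; rewrite il jl => v w; rewrite !tagged_asE.
  case: (dE l) => _ _ _ + evu ewu [du] [dw].
  by move=> /(_ _ _ _ evu ewu du dw) ->.
- by move=> _ /eqP/db-> [].
- by move=> /eqP/db-> _ _ [].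
Qed.

Variable R : comPzRingType.

(** The eigenvalue equation on one branch with the value at the center normalized to 1; [q] is what
    the branch sends back to the center, 0 if [b i] is [None]. *)
Definition branch_solution (i : I) (x q : R) (g : V i -> R) : Prop :=
  (forall v, (b i == Some v)%:R + \sum_(w | E v w) g w = x * g v) /\
  \sum_(v | b i == Some v) g v = q.

Lemma join_solution (x : R) (q : I -> R) (g : forall i, V i -> R) :
    (forall i, branch_solution x (q i) (g i)) ->
  let f y := if y is Some u then g (tag u) (tagged u) else 1 in
  \sum_(y | join_rel E b None y) f y = \sum_i q i /\
  forall u, \sum_(y | join_rel E b (Some u) y) f y = x * f (Some u).
Proof.
move=> gE f; split=> [|[i v]]; rewrite big_option /=.
  rewrite add0r; under [RHS]eq_bigr => i _ do rewrite -(gE i).2.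
  by rewrite sig_big_dep.
rewrite -(gE i).1; congr (_ + _); first by case: ifP.
rewrite -(sig_big_dep (fun=> true) (fun j w => join_rel E b (Some (Tagged V v)) (Some (Tagged V w)))
  (fun j w => g j w)) (bigD1 i) //= [X in _ + X]big1 ?addr0 => [|j ji].
  by apply: eq_bigl => w; rewrite eqxx tagged_asE.
by rewrite big_pred0 // => w; rewrite eq_sym (negbTE ji).
Qed.

End Join.

Lemma vertex1E (n : nat) (v : 'I_n) : (vertex1 n == Some v) = (v == 0%N :> nat).
Proof.
rewrite /vertex1; case: insubP => [u _ u0|].
  by rewrite -u0 [RHS]eq_sym; apply/eqP/eqP => [[->]|/val_inj->].
by move: v => [[|m] h] //=; rewrite ?h.
Qed.

Lemma A_relE (n : nat) (v w : 'I_n) :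
  A_rel v w = (w == v.+1 :> nat) || ((0 < v)%N && (w == v.-1 :> nat)).
Proof.
rewrite /A_rel /dynkin_rel /A_edge /=.
by apply/idP/idP; lia.
Qed.

Lemma A_rooted_forest (n : nat) : rooted_forest (@A_rel n) (@nat_of_ord n).
Proof.
split.
- by move=> v w; rewrite /A_rel /dynkin_rel orbC.
- by move=> v; rewrite A_relE; lia.
- by move=> v w; rewrite A_relE; lia.
- move=> u v w _ _ uw vw; apply: val_inj => /=.
  by move: uw; rewrite vw => -[].
Qed.

(** Counting from 0, [m] is the branching vertex and [m.+1], [m.+2] are the two leaves attached to
    it. *)
Lemma D_relE (m : nat) (v w : 'I_(m.+3)) : D_rel v w =
  if (v < m)%N then (w == v.+1 :> nat) || ((0 < v)%N && (w == v.-1 :> nat))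
  else if v == m :> nat then
    ((w == m.+1 :> nat) || (w == m.+2 :> nat)) || ((0 < m)%N && (w == m.-1 :> nat))
  else w == m :> nat.
Proof.
have := ltn_ord v; have := ltn_ord w.
rewrite /D_rel /dynkin_rel /D_edge => wm vm.
case: (ltnP v m) => [lt_vm|le_mv]; last case: (eqVneq (v : nat) m) => [eq_vm|neq_vm].
- by apply/idP/idP; lia.
- by apply/idP/idP; lia.
- by apply/idP/idP; lia.
Qed.

(** The truncation gives both leaves the depth [m.+1]. *)
Lemma D_rooted_forest (m : nat) :
  rooted_forest (@D_rel m.+3) (fun v => minn v m.+1).
Proof.
split.
- by move=> v w; rewrite /D_rel /dynkin_rel orbC.
- move=> v; rewrite D_relE.
  by case: (ltnP v m) => ?; last case: (eqVneq (v : nat) m) => ?; lia.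
- move=> v w; rewrite D_relE; have := ltn_ord v; have := ltn_ord w.
  by case: (ltnP v m) => ?; last case: (eqVneq (v : nat) m) => ?; lia.
- move=> u v w _ _; have := ltn_ord u; have := ltn_ord v; have := ltn_ord w.
  by move=> ? ? ? ? ?; apply: val_inj => /=; lia.
Qed.

Section BranchSolutions.
Variables (R : realType) (s : R).
Hypothesis s1 : 1 < s.

Let s0 : s != 0. Proof. by rewrite gt_eqF // (lt_trans ltr01). Qed.
Let N11 : -1 <= 1 :> R. Proof. exact: lerN11. Qed.

(** Along the path the value is 1 at the center, thought of as position -1, and 0 at the missing
    position [n]. *)
Definition A_solution (n a : nat) : R := hyp (-1) (n - a) s / hyp (-1) n.+1 s.

(** The recurrence would continue past the branching vertex with [hyp 1 0 s = 2]; the two leaves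
    share this value equally. The center, at position -1, again has value 1. *)
Definition D_solution (n a : nat) : R :=
  (if (a < n - 2)%N then hyp 1 (n - 2 - a) s else 1) / hyp 1 n.-1 s.

Lemma A_solution_gt0 (n a : nat) : (a < n)%N -> 0 < A_solution n a.
Proof.
by move=> an; rewrite /A_solution -(subnSK an) divr_gt0 // hypS_gt0.
Qed.

Lemma D_solution_gt0 (n a : nat) : (3 <= n)%N -> 0 < D_solution n a.
Proof.
case: n => [|[|n]] // _; rewrite /D_solution divr_gt0 ?hypS_gt0 //.
by case: ltnP => // an; rewrite -(subnSK an) hypS_gt0.
Qed.

Lemma A_branch_solution (n : nat) :
  (forall v : 'I_n, (vertex1 n == Some v)%:R + \sum_(w | A_rel v w) A_solution n w
     = (s + s^-1) * A_solution n v) /\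
  \sum_(v | vertex1 n == Some v) A_solution n v = hyp_ratio (-1) n s.
Proof.
have hn : hyp (-1) n.+1 s != 0 by rewrite gt_eqF // hypS_gt0.
split=> [v|]; last first.
  under eq_bigl => v do rewrite vertex1E.
  rewrite (big_ord1_eq _ (A_solution n)) /A_solution /hyp_ratio subn0.
  by case: n hn => //= _; rewrite /hyp !expr0 mulr1 subrr mul0r.
have vn := ltn_ord v.
under eq_bigl => w do rewrite A_relE.
rewrite sum_orb; last by move=> w /eqP->; lia.
rewrite (big_ord1_eq _ (A_solution n)).
have -> : (if (v.+1 < n)%N then A_solution n v.+1 else 0) = A_solution n v.+1.
  case: ltnP => // nv; rewrite /A_solution (eqP (_ : n - v.+1 == 0)%N) ?subn_eq0 //.
  by rewrite /hyp !expr0 mulr1 subrr mul0r.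
rewrite addrCA vertex1E.
(* The neighbour towards the center, which is the center itself for [v = 0], fits the same
   formula. *)
have -> : (v == 0%N :> nat)%:R + \sum_(w < n | (0 < v)%N && (w == v.-1 :> nat)) A_solution n w
    = hyp (-1) (n - v).+1 s / hyp (-1) n.+1 s.
  case: posnP => [->|v0] /=; first by rewrite big_pred0 // addr0 subn0 divff.
  rewrite add0r (big_ord1_eq _ (A_solution n)) (leq_ltn_trans (leq_pred v)) //.
  by rewrite /A_solution (_ : n - v.-1 = (n - v).+1)%N //; lia.
rewrite /A_solution -(subnSK vn) hypSS //.
by ring.
Qed.

Lemma D_branch_solution (n : nat) : (3 <= n)%N ->
  (forall v : 'I_n, (vertex1 n == Some v)%:R + \sum_(w | D_rel v w) D_solution n w
     = (s + s^-1) * D_solution n v) /\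
  \sum_(v | vertex1 n == Some v) D_solution n v = hyp_ratio 1 (n - 2) s.
Proof.
case: n => [|[|[|m]]] // _.
have hm : hyp 1 m.+2 s != 0 by rewrite gt_eqF // hypS_gt0.
split=> [v|]; last first.
  under eq_bigl => v do rewrite vertex1E.
  by rewrite (big_ord1_eq _ (D_solution m.+3)).
have vn := ltn_ord v.
have inner a : (a <= m)%N -> D_solution m.+3 a = hyp 1 (m.+1 - a) s / hyp 1 m.+2 s.
  by move=> am; rewrite /D_solution !subSS subn0 ltnS am.
have leaf a : (m < a)%N -> D_solution m.+3 a = 1 / hyp 1 m.+2 s.
  by move=> am; rewrite /D_solution !subSS subn0 ltnS leqNgt am.
have parent : (v <= m)%N -> (v == 0%N :> nat)%:R +
    \sum_(w < m.+3 | (0 < v)%N && (w == v.-1 :> nat)) D_solution m.+3 w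
    = hyp 1 (m.+1 - v).+1 s / hyp 1 m.+2 s.
  move=> vm; case: posnP => [->|v0] /=; first by rewrite big_pred0 // addr0 subn0 divff.
  rewrite add0r (big_ord1_eq _ (D_solution m.+3)) (leq_ltn_trans (leq_pred v)) //.
  by rewrite inner ?(leq_trans (leq_pred v)) // (_ : m.+1 - v.-1 = (m.+1 - v).+1)%N //; lia.
under eq_bigl => w do rewrite D_relE.
rewrite vertex1E; case: (ltnP v m) => [vm|mv]; last case: (eqVneq (v : nat) m) => [vm|vm].
- rewrite sum_orb; last by move=> w /eqP->; lia.
  rewrite (big_ord1_eq _ (D_solution m.+3)) ifT; last by lia.
  rewrite addrCA parent 1?ltnW // !inner // 1?ltnW //.
  rewrite (_ : m.+1 - v = (m.+1 - v.+1).+1)%N; last by lia.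
  by rewrite (hypSS _ (m.+1 - v.+1)) //; ring.
- rewrite sum_orb; last by move=> w; lia.
  rewrite sum_orb; last by move=> w /eqP->; lia.
  rewrite !(big_ord1_eq _ (D_solution m.+3)) !ifT //.
  move: parent; rewrite vm => /(_ (leqnn m)) parent.
  rewrite addrCA parent (inner m) // !leaf // subSnn.
  by rewrite (hypSS _ 0) // (_ : hyp 1 0 s = 2) /hyp ?expr0 ?mulr1 //; ring.
- rewrite (big_ord1_eq _ (D_solution m.+3)) ifT; last by lia.
  rewrite (inner m) // leaf; last by lia.
  rewrite subSnn (_ : (v == 0%N :> nat) = false); last by lia.
  by rewrite (_ : hyp 1 1 s = s + s^-1) /hyp ?expr1 ?mul1r // add0r.
Qed.

End BranchSolutions.

(** The intermediate value theorem turns the inequality at [t] into an equality further right, hence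
    into a true eigenvalue. At [u = t + |M|] the bound gives [H u <= M <= u]. *)
Lemma threshold_attained (R : realType) (H : R -> R) (t : R) :
    admissible H -> (forall s, 1 < s -> {for s, continuous H}) ->
    1 < t -> t + t^-1 <= H t ->
  exists2 s, t <= s & H s = s + s^-1.
Proof.
move=> [_ [M HM]] Hc t1 tH.
pose F s := s + s^-1 - H s; pose u := t + `|M|.
have tu : t <= u by rewrite lerDl.
have Fu : 0 <= F u.
  have u1 : 1 < u by apply: lt_le_trans tu.
  have uV : 0 < u^-1 by rewrite invr_gt0 (lt_trans ltr01).
  have := HM u u1; have := ler_norm M.
  by rewrite /F /u in uV *; lra.
have Ft : F t <= 0 by rewrite subr_le0.
have Fc (s : R) : 1 < s -> {for s, continuous F}.
  move=> s1; have V : {for s, continuous (fun x : R => x^-1)}.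
    by apply: inv_continuous; rewrite gt_eqF // (lt_trans ltr01).
  by apply: continuousB (Hc s s1); apply: continuousD V; exact: cvg_id.
have [||s] := @IVT R F t u 0 tu.
- apply: continuous_in_subspaceT => s; rewrite inE /= in_itv /= => /andP[ts _].
  by apply: Fc; apply: lt_le_trans ts.
- by rewrite ge_min Ft le_max Fu orbT.
rewrite in_itv /= => /andP[ts _] /eqP; rewrite subr_eq0 => /eqP Fs.
by exists s.
Qed.

(** * The spectral radius of the trees as a threshold *)

Section Star.
Variables (R : realType) (i : nat) (p : seq nat).
Hypothesis p3 : forall j, (j < i)%N -> (j < size p)%N -> (3 <= nth 0 p j)%N.

Let q (s : R) := \sum_(j < size p) branch_ratio (j < i)%N (nth 0%N p j) s.

Lemma S_rooted_forest : exists d, rooted_forest (@S_rel i p) d.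
Proof.
pose d (j : 'I_(size p)) (v : 'I_(nth 0%N p j)) :=
  if (j < i)%N then minn v (nth 0 p j - 2) else v : nat.
exists (fun x => if x is Some u then (d (tag u) (tagged u)).+1 else 0%N).
apply: join_rooted_forest => j; last first.
  move=> v /eqP; rewrite vertex1E /d => /eqP ->.
  by rewrite min0n; case: ifP.
rewrite /d; case: ltnP => [ji|_]; last exact: A_rooted_forest.
have := p3 ji (ltn_ord j).
move: (nth 0%N p j) => [|[|[|n]]] // _; exact: D_rooted_forest.
Qed.

Lemma S_solution (s : R) : 1 < s ->
  exists f : option {j : 'I_(size p) & 'I_(nth 0%N p j)} -> R,
  [/\ forall v, 0 < f v, f None = 1,
      \sum_(w | @S_rel i p None w) f w = q s &
      forall u, \sum_(w | @S_rel i p (Some u) w) f w = (s + s^-1) * f (Some u)].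
Proof.
move=> s1.
pose g (j : 'I_(size p)) (v : 'I_(nth 0%N p j)) :=
  if (j < i)%N then D_solution s (nth 0%N p j) v else A_solution s (nth 0%N p j) v.
have [|fN fS] := @join_solution _ _
  (fun j : 'I_(size p) => if (j < i)%N then @D_rel (nth 0%N p j) else @A_rel (nth 0%N p j))
  (fun j => vertex1 (nth 0%N p j)) R (s + s^-1)
  (fun j => branch_ratio (j < i)%N (nth 0%N p j) s) g.
  move=> j; rewrite /branch_solution /g /branch_ratio.
  case: ltnP => [ji|_]; last exact: A_branch_solution.
  exact: D_branch_solution (p3 ji (ltn_ord j)).
exists (fun y => if y is Some u then g (tag u) (tagged u) else 1); split=> //.
move=> [[j v]|] //=; rewrite /g; case: ifP => [ji|_].
  by apply: D_solution_gt0 (p3 ji (ltn_ord j)).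
exact: A_solution_gt0.
Qed.

Lemma admissible_q : admissible q.
Proof.
split=> [s t s1 st|].
  by apply: ler_sum => j _; apply: (admissible_branch _ _ _).1.
exists (size p)%:R => s s1.
have -> : (size p)%:R = \sum_(j < size p) 1 :> R.
  by rewrite big_const_ord iter_addr_0.
have N11 := lerN11 R.
apply: ler_sum => j _; rewrite /branch_ratio.
by case: ifP => _; apply: hyp_ratio_le1.
Qed.

Lemma continuous_q (s : R) : 1 < s -> {for s, continuous q}.
Proof.
move=> s1; have N11 := lerN11 R.
pose Q (r : seq 'I_(size p)) (x : R) :=
  \sum_(j <- r) branch_ratio (j < i)%N (nth 0%N p j) x.
rewrite -[q]/(Q (index_enum _)); elim: (index_enum _) => [|j r IH].
  have -> : Q [::] = fun=> 0 by apply/funext => x; rewrite /Q big_nil.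
  exact: cst_continuous.
have -> : Q (j :: r) = fun x => branch_ratio (j < i)%N (nth 0%N p j) x + Q r x.
  by apply/funext => x; rewrite /Q big_cons.
apply: continuousD => //; rewrite /branch_ratio.
by case: ifP => _; apply: hyp_ratio_continuous.
Qed.

(** If [s] lies above the threshold, the positive solution is a supersolution and bounds [rho] by
    [s^2]. Conversely, a point [t > r] with [t + 1/t <= q t] would yield an eigenvector for some
    [s >= t], contradicting [s^2 <= rho]. *)
Lemma rho_S : rho R (cox (@S_rel i p)) = threshold q ^+ 2.
Proof.
have [d dS] := S_rooted_forest; have aq := admissible_q.
have r1 : 1 <= rho R (cox (@S_rel i p)).
  by apply: rho_ge1 dS _; apply/card_gt0P; exists None.
have r0 := le_trans ler01 r1.
set r := Num.sqrt (rho R (cox (@S_rel i p))).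
have rE : rho R (cox (@S_rel i p)) = r ^+ 2 by rewrite sqr_sqrtr.
have r'1 : 1 <= r by rewrite /r -[leLHS]sqrtr1 ler_wsqrtr.
rewrite rE; congr (_ ^+ 2); apply/eqP; rewrite eq_le; apply/andP; split.
  rewrite leNgt; apply/negP => Tr.
  (* An intermediate point is used because the threshold may be 1, whereas the solution requires
     [s > 1]. *)
  have [s Ts sr] : exists2 s, threshold q < s & s < r.
    by exists ((threshold q + r) / 2); rewrite ?midf_lt.
  have s1 : 1 < s by apply: le_lt_trans Ts; apply: threshold_ge1.
  have [f [f0 fN fqN fqS]] := S_solution s1.
  have : rho R (cox (@S_rel i p)) <= s ^+ 2.
    apply: (rho_le_supersolution dS s1 f0) => -[u|]; first by rewrite fqS.
    by rewrite fqN fN mulr1 ltW // threshold_gt.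
  rewrite rE leNgt ltr_sqr ?nnegrE ?sr // ltW //; first exact: lt_trans s1.
  exact: lt_le_trans r'1.
apply: threshold_le => // t rt; rewrite ltNge; apply/negP => tq.
have t1 : 1 < t by apply: le_lt_trans rt.
have [s ts sE] := threshold_attained aq continuous_q t1 tq.
have s1 : 1 < s by apply: lt_le_trans ts.
have [f [f0 fN fqN fqS]] := S_solution s1.
have : s ^+ 2 <= rho R (cox (@S_rel i p)).
  apply: (rho_ge_eigenvalue dS s1 (f := f)); split.
    by exists None; rewrite fN oner_neq0.
  by move=> [u|] //; rewrite fqN fN mulr1.
rewrite rE leNgt ltr_sqr ?nnegrE ?(lt_le_trans rt ts) //.
  exact: le_trans r'1.
by rewrite ltW // (lt_trans _ s1).
Qed.

End Star.

Theorem theorem2p4 (R : realType) (k i : nat) (hk : (2 <= k)%N)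
    (hi : (i <= k)%N) :
  is_iterated_lim (nseq i 3 ++ nseq (k - i) 0)%N
    (fun p : seq nat => rho R (cox (@S_rel i p))) (k%:R - 1).
Proof.
have a0 : admissible (fun=> 0 : R) by split=> //; exists 0.
have := threshold_iterated_lim (nseq i 3 ++ nseq (k - i) 0)%N (fun j => j < i)%N a0.
have -> : threshold (fun s : R =>
    0 + (size (nseq i 3 ++ nseq (k - i) 0)%N)%:R / s) ^+ 2 = k%:R - 1.
  rewrite size_cat !size_nseq subnKC // -threshold_natV //.
  by congr (threshold _ ^+ 2); apply/funext => s; rewrite add0r.
apply: is_iterated_lim_ext => p _ mp; rewrite rho_S.
  by congr (threshold _ ^+ 2); apply/funext => s; rewrite add0r.
(* The first [i] lower bounds are 3, as [rho_S] requires for the D branches. *)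
move=> j ji _; apply: leq_trans (mp j).
by rewrite nth_cat size_nseq ji nth_nseq ji.
Qed.
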